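(* Let $N$ be a natural number whose Bergman expansion has $n+1$ digits $1$ (with $n\ge 0$), and write this expansion, with the radix point removed, as $$10^{s_n}\,10^{s_{n-1}}\cdots 10^{s_1}\,1 .$$ Define $r_0=1$, and $r_1=\frac12 s_1+1$ if $s_1$ is even, $r_1=\frac12(s_1+1)+1$ if $s_1$ is odd, and for $k\ge 2$ $$r_k=\begin{cases}\left[\frac12 s_k+1\right] r_{k-1} & \text{if } s_k \text{ is even},\\[2pt] \left[\frac12(s_k+1)+1\right] r_{k-1}-r_{k-2} & \text{if } s_k \text{ is odd}.\end{cases}$$ Then the number of Knott expansions of $N$ is $\mathrm{Tot}^{\kappa}(N)=r_n$.
   Context: Let $\varphi=(1+\sqrt5)/2$. A finite base phi expansion of $N$ is a sequence $(a_i)_{i\in\mathbb Z}$ with $a_i\in\{0,1\}$, only finitely many $a_i$ nonzero, and $N=\sum_i a_i\varphi^i$. The Bergman expansion $\beta(N)$ is the unique finite base phi expansion $(d_i)$ of $N$ in which $d_{i+1}d_i=11$ never occurs; it is written $d_L d_{L-1}\dots d_0\cdot d_{-1}\dots d_R$ with $d_L=d_R=1$ the first and last nonzero digits (so the word obtained by removing the radix point begins and ends with $1$). Here $0^s$ denotes a block of $s$ zeros. A Knott expansion of $N$ is a finite base phi expansion $(a_i)$ of $N$ such that, if $R$ denotes the smallest index with $a_R=1$, then $a_{R+2}a_{R+1}a_R\neq 011$. The number of Knott expansions of $N$ is denoted $\mathrm{Tot}^{\kappa}(N)$ (it is finite). *)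

(* Defs.v *)
From HB Require Import structures.
From mathcomp Require Import all_boot all_order all_algebra.
From mathcomp Require Import finmap.
From mathcomp Require Import all_classical all_reals.

Set Implicit Arguments.
Unset Strict Implicit.
Unset Printing Implicit Defensive.

Import Order.TTheory GRing.Theory Num.Theory.
Local Open Scope classical_set_scope.
Local Open Scope ring_scope.

Definition phi (R : realType) : R := (1 + Num.sqrt 5) / 2.

(* A digit sequence (a_i), i in Z, with a_i in {0,1} is a function int -> bool;
   booleans are read as 0 and 1 through the coercion of bool to nat. *)
Definition base_phi_expansion (R : realType) (N : nat) (a : int -> bool) : Prop :=
  finite_set [set i | a i] /\
  N%:R = \sum_(i \in [set: int]) (nat_of_bool (a i))%:R * phi R ^ i :> R.

Definition bergman_expansion (R : realType) (N : nat) (d : int -> bool) : Prop :=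
  base_phi_expansion R N d /\ forall i : int, ~ (d (i + 1) /\ d i).

Definition knott_expansion (R : realType) (N : nat) (a : int -> bool) : Prop :=
  base_phi_expansion R N a /\
  forall lo : int, a lo -> (forall i : int, a i -> lo <= i) ->
    [:: a (lo + 2); a (lo + 1); a lo] <> [:: false; true; true].

(* fset_set is the empty set on infinite sets, so that this is the number of
   Knott expansions only when there are finitely many of them. *)
Definition tot_knott (R : realType) (N : nat) : nat :=
  #|` fset_set [set a | knott_expansion R N a] |%fset.

(* w is the word d_hi ... d_lo (radix point removed), where hi and lo are the
   largest and the smallest index of a nonzero digit. *)
Definition digit_word (d : int -> bool) (w : seq bool) : Prop :=
  exists hi lo : int,
    [/\ d hi, d lo, (forall i : int, d i -> lo <= i <= hi) &
        w = mkseq (fun k => d (hi - k%:Z)) `|hi - lo|%N.+1].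

(* 1 0^(s n) 1 0^(s n.-1) ... 1 0^(s 1) 1; the value s 0 is not used. *)
Definition block_word (s : nat -> nat) (n : nat) : seq bool :=
  flatten [seq true :: nseq (s k) false | k <- rev (iota 1 n)] ++ [:: true].

Fixpoint r (s : nat -> nat) (k : nat) : int :=
  match k with
  | 0%N => 1
  | 1%N => if odd (s 1%N) then ((s 1%N).+1./2)%:Z + 1 else ((s 1%N)./2)%:Z + 1
  | (k''.+1 as k').+1 =>
      if odd (s k) then (((s k).+1./2)%:Z + 1) * r s k' - r s k''
      else (((s k)./2)%:Z + 1) * r s k'
  end.

(* Main.v *)
From HB Require Import structures.
Require Import Defs.
From mathcomp Require Import all_boot all_order all_algebra.
From mathcomp Require Import finmap.
From mathcomp Require Import all_classical all_reals.
From mathcomp Require Import zify lra.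

(** Write both an arbitrary expansion [a] of [N] and the Bergman expansion [d]
on a common window and read them from the top digit down.  The carry at a
position is the difference between the part of [d] and the part of [a] read
so far, in units of the power of phi at that position; reading the digits
[x] of [d] and [a] of the other expansion replaces a carry [c] by
[c * phi + x - a], and the two sequences have the same value when the final
carry is 0.  The unread digits of [a] are worth less than phi, and those of
[d], which has no two adjacent ones, less than 1.  A carry that is at least
phi or at most -1 can therefore never be paid back, and using
phi^2 = phi + 1 this leaves only the carries 0, 1 and phi - 1 = 1/phi.  So
the expansions of [N] are the words accepted by a small automaton fed with
the digits of [d] ([acceptsP]).

Below the last digit 1 of [d] the automaton sees only zeros.  A carry 0 then
forces zeros, and a carry 1 forces [a] to continue with (10)^i 11 0^j.  Such a
continuation makes [a] end in 011, except when i = 0 and the digit of [a]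
opposite the last 1 of [d] is itself 1; this happens when that position
turned a carry 1/phi into a carry 1.  For instance 101.01 and 100.1111 are
both Knott expansions of 4, although the second one reaches two places
further down.  A Knott expansion thus lives on the window of [d] lengthened by
two digits and ends there either with carry 0 and the digits 00, or with a
carry 1 born from 1/phi and the digits 11 ([accepts_knott]).  Conversely none
of the words so described ends in 011, because the last two digits of [d] are
01 ([knott_words_no011]).  Hence Knott expansions correspond to an explicit
list of words ([knott_expansionE]).

The length of that list is computed by reading [d] one block at a time.  Let
K_k be the number of continuations from carry 0 on the last k blocks.  At the
leading 1 of a block 1 0^m either the carry stays 0, giving K_(k-1)
continuations, or it becomes 1 and then alternates between 1/phi and 1 along
the zeros; each 1/phi met above a zero may be paid back at that zero, giving
K_(k-1) continuations each time, that is m/2 times, rounded down.  When m is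
odd the next digit 1 of [d] is met with carry 1/phi, which yields a further
K_(k-1) - K_(k-2) continuations.  This is the recurrence of [r]; in the lowest
block the carry 1 born from 1/phi at the last digit counts for one, which is
why K_(-1) has to be read as 0 there ([count_block_word]). *)

Set Implicit Arguments.
Unset Strict Implicit.
Unset Printing Implicit Defensive.

Import Order.TTheory GRing.Theory Num.Theory.
Local Open Scope classical_set_scope.
Local Open Scope ring_scope.

(** * The golden ratio and the values of words *)

Lemma phi_sqr (R : realType) : phi R * phi R = phi R + 1.
Proof.
have h : Num.sqrt 5 ^+ 2 = 5 :> R by rewrite sqr_sqrtr.
by rewrite /phi; nra.
Qed.

Lemma phi_gt1 (R : realType) : 1 < phi R.
Proof.
have h : Num.sqrt 5 ^+ 2 = 5 :> R by rewrite sqr_sqrtr.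
have : 0 <= Num.sqrt 5 :> R by rewrite sqrtr_ge0.
by rewrite /phi; nra.
Qed.

Lemma phi_lt2 (R : realType) : phi R < 2.
Proof. by have := phi_sqr R; have := phi_gt1 R; nra. Qed.

Lemma phi_gt0 (R : realType) : 0 < phi R.
Proof. exact: lt_trans ltr01 (phi_gt1 R). Qed.

(** Words are read from the most significant digit down, the last digit having
weight 1. *)
Fixpoint word_val (R : realType) (w : seq bool) : R :=
  if w is b :: w' then (nat_of_bool b)%:R * phi R ^+ size w' + word_val R w'
  else 0.

Definition sparse (w : seq bool) : bool := sorted (fun x y => ~~ (x && y)) w.

Lemma word_val_ge0 (R : realType) w : 0 <= word_val R w.
Proof.
elim: w => //= b w IH; apply: addr_ge0 => //; apply: mulr_ge0 => //.
exact/exprn_ge0/ltW/phi_gt0.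
Qed.

Lemma word_val_lt (R : realType) w : word_val R w < phi R * phi R ^+ size w.
Proof.
elim: w => [|b w IH] /=; first by rewrite mulr1 phi_gt0.
have P0 : 0 < phi R ^+ size w by exact/exprn_gt0/phi_gt0.
have := phi_gt1 R; rewrite exprS mulrA phi_sqr mulrDl mul1r.
by case: b => /=; rewrite ?mul0r ?mul1r; lra.
Qed.

(** A leading 1 is followed by 0, and phi^k + phi^(k+1) = phi^(k+2) leaves room
for the rest. *)
Lemma sparse_val_lt (R : realType) w : sparse w -> word_val R w < phi R ^+ size w.
Proof.
have [m] := ubnP (size w); elim: m w => // m IH [|b w] //= => sz sp.
have P0 (u : seq bool) : 0 < phi R ^+ size u by exact/exprn_gt0/phi_gt0.
have h1 := phi_gt1 R; rewrite exprS.
have spw : sparse w := path_sorted sp.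
case: b sp; last first.
  by move=> _; rewrite mul0r add0r; have := IH w sz spw; have := P0 w; nra.
case: w sz spw => [|[] w] //=; first by rewrite mulr1 addr0 mulr1.
move=> sz spw sp; rewrite mul1r mul0r add0r exprS mulrA phi_sqr.
have : word_val R w < phi R ^+ size w.
  by apply: IH => //; [lia | exact: path_sorted spw].
lra.
Qed.

(** * The carry automaton *)

(** [CZero], [COne] and [CInv] are the carries 0, 1 and 1/phi.  The carry 1 is
duplicated: [COneEnd] records that it arose from the carry 1/phi by reading
1 in both words.  The distinction does not affect which words are accepted,
only where a Knott expansion may stop. *)
Inductive carry := CZero | COne | COneEnd | CInv.

Definition carry_eqb (x y : carry) : bool :=
  match x, y with
  | CZero, CZero | COne, COne | COneEnd, COneEnd | CInv, CInv => true
  | _, _ => false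
  end.

Lemma carry_eqP : Equality.axiom carry_eqb.
Proof. by case; case; constructor. Qed.

HB.instance Definition _ := hasDecEq.Build carry carry_eqP.

Definition carry_val (R : realType) (c : carry) : R :=
  match c with CZero => 0 | CInv => phi R - 1 | _ => 1 end.

Definition step (c : carry) (x a : bool) : option carry :=
  match c, x, a with
  | CZero, true, true | CZero, false, false => Some CZero
  | CZero, true, false => Some COne
  | COne, false, true | COneEnd, false, true => Some CInv
  | CInv, false, false => Some COne
  | CInv, false, true => Some CZero
  | CInv, true, true => Some COneEnd
  | _, _, _ => None
  end.

Fixpoint accepts (c : carry) (w v : seq bool) : bool :=
  match w, v with
  | [::], [::] => c == CZero
  | x :: w', a :: v' => if step c x a is Some c' then accepts c' w' v' else false
  | _, _ => false
  end.

(** In units of the next lower position a carry [c] becomes [c * phi], so an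
allowed step is an identity modulo phi^2 = phi + 1.  A missing step is one
whose result is either at least phi, more than the rest of [v] can be worth,
or equal to -1, which the rest of the sparse word [w] cannot make up for. *)
Lemma acceptsP (R : realType) c w v : sparse w -> size v = size w ->
  (carry_val R c * phi R ^+ size w + word_val R w == word_val R v) = accepts c w v.
Proof.
elim: w c v => [|x w IH] c [|a v] //=.
  move=> _ _; rewrite mulr1 addr0.
  by case: c => /=; rewrite ?eqxx ?subr_eq0 ?oner_eq0 ?gt_eqF ?phi_gt1.
move=> sp [sz].
have spw : sparse w := path_sorted sp.
have {}IH c' := IH c' v spw sz.
have P0 : 0 < phi R ^+ size w by exact/exprn_gt0/phi_gt0.
have x0 := word_val_ge0 R w.
have xP := sparse_val_lt R spw.
have y0 := word_val_ge0 R v.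
have := word_val_lt R v; rewrite sz exprS => yQ.
have h1 := phi_gt1 R; have h2 := phi_lt2 R.
have hQ : phi R * (phi R * phi R ^+ size w) =
          phi R * phi R ^+ size w + phi R ^+ size w.
  by rewrite mulrA phi_sqr mulrDl mul1r.
have PQ : phi R ^+ size w < phi R * phi R ^+ size w by nra.
have Q2 : phi R * phi R ^+ size w < 2 * phi R ^+ size w by nra.
have eqv c' p : p = carry_val R c' * phi R ^+ size w + word_val R w -
    word_val R v -> (p == 0) = accepts c' w v.
  by move=> ->; rewrite subr_eq0 IH.
rewrite -subr_eq0.
case: c x a sp => [] [] [] sp /=; rewrite ?(mul0r, mul1r, add0r, addr0);
  try (apply: eqv => /=; lra);
  (* Only the missing steps are left; they contradict the bounds. *)
  by apply/negbTE/eqP; lra.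
Qed.

(** * The words of Knott expansions *)

(** The digits of the Knott expansions opposite the word [w], together with the
two places below it.  Carry 0 continues with 00.  A carry 1 may be paid
with 11 if the digit before is 1, as it is for [COneEnd]; every other way of
paying it lets the expansion end in 011. *)
Fixpoint knott_words (c : carry) (w : seq bool) : seq (seq bool) :=
  if w is x :: w' then
    let next a := if step c x a is Some c' then map (cons a) (knott_words c' w')
                  else [::] in
    next false ++ next true
  else match c with
       | CZero => [:: [:: false; false]]
       | COneEnd => [:: [:: true; true]]
       | _ => [::]
       end.

Lemma mem_knott_cons c x w u :
  (u \in knott_words c (x :: w)) =
  (if u is a :: u' then
     if step c x a is Some c' then u' \in knott_words c' w else false
   else false).
Proof.
rewrite /= mem_cat; case: u => [|a u].
  apply/negbTE; rewrite negb_or; apply/andP.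
  by split; case: step => [?|] //; apply/mapP => -[].
have mem_map_cons b (c' : carry) : (a :: u \in map (cons b) (knott_words c' w)) =
    (a == b) && (u \in knott_words c' w).
  apply/mapP/andP => [[v vin [-> ->]]|[/eqP -> uin]]; first by rewrite eqxx.
  by exists u.
by case: a mem_map_cons => mem_map_cons;
  case: (step c x false) => [c0|]; case: (step c x true) => [c1|];
  rewrite ?mem_map_cons ?in_nil /= ?orbF.
Qed.

Lemma size_knott_words c w u : u \in knott_words c w -> size u = (size w).+2.
Proof.
elim: w c u => [|x w IH] c u; first by case: c; rewrite //= inE => /eqP ->.
rewrite mem_knott_cons; case: u => // a u.
by case: step => // c' /IH /= ->.
Qed.

Lemma knott_words_uniq c w : uniq (knott_words c w).
Proof.
elim: w c => [|x w IH] c; first by case: c.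
have inj a : injective (@cons bool a) by move=> u v [].
rewrite /= cat_uniq; apply/and3P; split.
- by case: step => // c'; rewrite map_inj_uniq.
- apply/hasPn => u.
  case: (step c x true) => // c1 /mapP[v _ ->].
  by case: (step c x false) => // c0; apply/mapP => -[].
- by case: step => // c'; rewrite map_inj_uniq.
Qed.

Lemma knott_words_zeros p w :
  knott_words CZero (nseq p false ++ w) =
  map (cat (nseq p false)) (knott_words CZero w).
Proof.
elim: p => [|p IH] /=; first by rewrite map_id.
by rewrite cats0 IH -map_comp.
Qed.

Lemma accepts_zero q v : accepts CZero (nseq q false) v -> v = nseq q false.
Proof. by elim: q v => [|q IH] [|[] v] //= /IH ->. Qed.

Lemma knott_words_accepts c w u : u \in knott_words c w ->
  accepts c (w ++ [:: false; false]) u.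
Proof.
elim: w c u => [|x w IH] c u.
  by case: c; rewrite //= inE => /eqP ->.
rewrite mem_knott_cons; case: u => // a u /=.
by case: step => // c' /IH.
Qed.

(** * Words ending in 011 *)

(** Since digits beyond the end of a word are read as 0, this says that the last
nonzero digit and the two digits before it form 011, without reference to the
length of the word. *)
Definition ends011 (v : seq bool) : Prop :=
  exists k, [/\ ~~ nth false v k, nth false v k.+1, nth false v k.+2 &
    forall j, (k.+2 < j)%N -> ~~ nth false v j].

Lemma ends011_cons b v : ends011 v -> ends011 (b :: v).
Proof.
move=> [k [h0 h1 h2 h]]; exists k.+1; split=> // -[|j] // kj.
exact: h.
Qed.

Lemma ends011_intro q : ends011 ([:: false; true; true] ++ nseq q false).
Proof. by exists 0%N; split=> // -[|[|[|j]]] //= _; rewrite nth_nseq if_same. Qed.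

(** Against zeros a carry 1 becomes 1/phi by writing 1, and then either
disappears by writing another 1 or is 1 again after writing 0.  So [v] has the
form (10)^i 11 0^j, and a 0 in front always completes a final 011. *)
Lemma accepts_one_ends011 q v :
  accepts COne (nseq q false) v -> ends011 (false :: v).
Proof.
have [m] := ubnP q; elim: m q v => // m IH [|[|q]] [|[] [|b v]] //= qm.
case: b => /= [/accepts_zero ->|/IH bad]; first exact: ends011_intro.
by do 2 apply: ends011_cons; apply: bad; lia.
Qed.

Lemma accepts_oneEnd q v : accepts COneEnd (nseq q.+2 false) v ->
  ~ ends011 v -> v = [:: true, true & nseq q false].
Proof.
case: v => [|[] [|[] v]] //= => [/accepts_zero -> //|/accepts_one_ends011 bad].
by case; apply: ends011_cons.
Qed.

(** What the carry remembers of the previous digit of the expansion: the carry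
[COne] is only entered by writing 0. *)
Definition last_digit (c : carry) : seq bool :=
  if c == COne then [:: false] else [::].

(** A Knott expansion cannot go on below the last 1 of [w] other than by 00 or
11.  The side condition on [last] excludes the carry 1/phi at the end of [w]:
it is only entered by reading 0, whereas [w] ends in 1. *)
Lemma accepts_knott c w q v : last (c != CInv) w ->
  accepts c (w ++ nseq q.+2 false) v -> ~ ends011 (last_digit c ++ v) ->
  exists2 u, u \in knott_words c w & v = u ++ nseq q false.
Proof.
elim: w c v => [|x w IH] c v.
  move=> cI; rewrite cat0s => acc nbad; case: c cI acc nbad => // _.
  - by move=> /accepts_zero -> _; exists [:: false; false].
  - by move=> /accepts_one_ends011.
  - by move=> /accepts_oneEnd acc /acc ->; exists [:: true; true].
move=> lastw; case: v => [|a v] //= acc nbad.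
case E: step acc => [c'|//] acc.
have [||u uin ->] := IH c' v _ acc.
- case: (w) lastw => //= xt; move: xt E; case: x => // _.
  by case: (c) (a) => [] [] //= [<-].
- move=> bad; apply: nbad.
  suff : ends011 (a :: v) by rewrite /last_digit; case: eqP => // _; exact: ends011_cons.
  move: bad; rewrite /last_digit; case: eqP => [c1|_]; last exact: ends011_cons.
  by move: E; rewrite c1; case: (c) (x) (a) => [] [] [].
- exists (a :: u) => //; rewrite mem_knott_cons E //.
Qed.

(** All cases are settled by the last three digits x01 of [w] and the two places
below.  A final 011 can also not be created further up, since every listed
word has a nonzero digit from index 2 on; this is the part of the conclusion
that makes the induction go through. *)
Lemma knott_words_no011 c w u : sparse w -> last false w -> (2 < size w)%N ->
  u \in knott_words c w ->
  ~ ends011 u /\ exists2 j, (1 < j)%N & nth false u j.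
Proof.
elim: w c u => [|x w IH] c u //= sp lastw; rewrite ltnS leq_eqVlt.
case/orP => [/eqP|] sz; last first.
  rewrite mem_knott_cons; case: u => // a u.
  case: step => // c' uin.
  have lw : last false w by case: (w) sz lastw.
  have [nbad [j j1 uj]] := IH c' u (path_sorted sp) lw sz uin.
  split; last by exists j.+1 => //; exact: ltnW.
  case=> [] [|k] [h0 h1 h2 h]; last first.
    by apply: nbad; exists k; split=> // i ki; apply: (h i.+1).
  by have := h j.+1 j1; rewrite /= uj.
case: x w sz lastw sp {IH} => [] [|[] [|[] [|? ?]]] //= _ _ _.
all: case: c => //=; rewrite ?inE; try case/orP; move=> /eqP ->.
all: split; last by exists 2%N.
all: case=> [] [|[|[|[|[|k]]]]] [] //=; rewrite ?nth_nil //.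
all: by move=> _ _ _ /(_ 3%N isT).
Qed.

(** * Counting the words *)

Lemma count_zero_zeros p w :
  size (knott_words CZero (nseq p false ++ w)) = size (knott_words CZero w).
Proof. by rewrite knott_words_zeros size_map. Qed.

(** Opposite 00 a carry 1 becomes 1/phi, and then either stays pending as 1 or is
paid back. *)
Lemma count_one_00 w : size (knott_words COne [:: false, false & w]) =
  (size (knott_words COne w) + size (knott_words CZero w))%N.
Proof. by rewrite /= size_map size_cat !size_map. Qed.

Lemma count_one_even t w :
  size (knott_words COne (nseq t.*2 false ++ true :: w)) =
  (t * size (knott_words CZero (true :: w)))%N.
Proof.
elim: t => [|t IH] //; rewrite doubleS mulSn addnC -IH.
by rewrite [LHS]count_one_00 count_zero_zeros.
Qed.

Lemma count_one_odd t w :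
  size (knott_words COne (nseq t.*2.+1 false ++ true :: w)) =
  (size (knott_words COneEnd w) + t * size (knott_words CZero (true :: w)))%N.
Proof.
elim: t => [|t IH]; first by rewrite addn0 /= !size_map.
rewrite doubleS mulSn addnCA addnC -IH.
by rewrite [LHS]count_one_00 (count_zero_zeros t.*2.+1).
Qed.

Lemma count_zero_one w : size (knott_words CZero (true :: w)) =
  (size (knott_words COne w) + size (knott_words CZero w))%N.
Proof. by rewrite /= size_cat !size_map. Qed.

Lemma block_wordS (s : nat -> nat) n :
  block_word s n.+1 = true :: nseq (s n.+1) false ++ block_word s n.
Proof.
rewrite /block_word; have -> : iota 1 n.+1 = rcons (iota 1 n) n.+1.
  by rewrite -{1}(addn1 n) iotaD cats1.
by rewrite rev_rcons /= -catA.
Qed.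

Lemma block_wordE (s : nat -> nat) n : exists w, block_word s n = true :: w.
Proof.
case: n => [|n]; first by exists [::].
by eexists; exact: block_wordS.
Qed.

Lemma last_block_word (s : nat -> nat) n b : last b (block_word s n).
Proof. by rewrite /block_word last_cat. Qed.

(** The remaining term for an odd block length is the count from [COneEnd] on the
lower blocks after their leading 1.  It equals the count from [COne] unless
nothing is left, and the latter is K_(n+1) - K_n by [count_zero_one]. *)
Lemma count_block_word (s : nat -> nat) n :
  (size (knott_words CZero (block_word s n)))%:Z = r s n.
Proof.
have rE k : r s k.+2 = if odd (s k.+2)
    then (((s k.+2).+1./2)%:Z + 1) * r s k.+1 - r s k
    else (((s k.+2)./2)%:Z + 1) * r s k.+1 by [].
have even_or_odd m : {t | m = t.*2} + {t | m = t.*2.+1}.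
  rewrite -(odd_double_half m); case: (odd m); last by left; exists m./2.
  by right; exists m./2.
have [m] := ubnP n; elim: m n => // m IH [|[|n]] // nm.
- rewrite block_wordS count_zero_one count_zero_zeros /r.
  case: (even_or_odd (s 1%N)) => -[t ->].
    by rewrite count_one_even odd_double doubleK muln1.
  by rewrite count_one_odd /= odd_double /= doubleK muln1; lia.
- have IH1 := IH n.+1 nm; have IH0 := IH n (ltnW nm).
  have [w Ew] := block_wordE s n.+1.
  have cw : (size (knott_words COneEnd w) + size (knott_words CZero (block_word s n)) =
      size (knott_words CZero (block_word s n.+1)))%N.
    rewrite Ew count_zero_one; move: Ew; rewrite block_wordS => -[<-].
    rewrite count_zero_zeros; congr addn.
    have [w' ->] := block_wordE s n.
    by case: (s n.+1).
  rewrite block_wordS count_zero_one count_zero_zeros rE -IH1 -IH0 -cw.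
  case: (even_or_odd (s n.+2)) => -[t ->].
    by rewrite odd_double doubleK Ew count_one_even -Ew -cw; lia.
  by rewrite /= odd_double /= doubleK Ew count_one_odd -Ew -cw; lia.
Qed.

(** * From digit sequences to words *)

Definition digits (a : int -> bool) (M : int) (T : nat) : seq bool :=
  mkseq (fun k => a (M - k%:Z)) T.

Definition supported (a : int -> bool) (M : int) (T : nat) : Prop :=
  forall i, a i -> M - T%:Z < i <= M.

Lemma size_digits a M T : size (digits a M T) = T.
Proof. exact: size_mkseq. Qed.

Lemma digits_cat a M T1 T2 :
  digits a M (T1 + T2) = digits a M T1 ++ digits a (M - T1%:Z) T2.
Proof.
rewrite /digits /mkseq iotaD map_cat; congr cat.
rewrite add0n -[T1 in iota T1]addn0 iotaDl -map_comp; apply: eq_map => k /=.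
by congr (a _); lia.
Qed.

Lemma digits_false a M T : (forall i, M - T%:Z < i <= M -> ~~ a i) ->
  digits a M T = nseq T false.
Proof.
move=> h; apply: (@eq_from_nth _ false); rewrite size_digits ?size_nseq // => k kT.
by rewrite nth_mkseq // nth_nseq kT; apply/negbTE/h; lia.
Qed.

Lemma nth_digits a M T k : supported a M T ->
  nth false (digits a M T) k = a (M - k%:Z).
Proof.
move=> sa; have [kT|Tk] := ltnP k T; first by rewrite nth_mkseq.
rewrite nth_default ?size_digits //; apply/esym/negbTE/negP => /sa; lia.
Qed.

Lemma sum_digits (R : realType) a M T :
  \sum_(0 <= k < T) (nat_of_bool (a (M - k%:Z)))%:R * phi R ^ (M - k%:Z) =
  phi R ^ (M - T%:Z + 1) * word_val R (digits a M T).
Proof.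
have phi_n0 : phi R != 0 by rewrite gt_eqF ?phi_gt0.
elim: T M => [|T IH] M; first by rewrite big_geq //= mulr0.
rewrite big_nat_recl // -(add1n T) digits_cat /= subr0 size_digits mulrDr.
congr (_ + _).
  by rewrite mulrCA exprnP -expfzDr //; congr (_ * _ ^ _); lia.
rewrite [X in phi R ^ X](_ : _ = (M - 1) - T%:Z + 1); last by lia.
rewrite -IH; apply: eq_bigr => k _.
by rewrite (_ : M - k.+1%:Z = M - 1 - k%:Z) //; lia.
Qed.

Lemma base_phi_expansionE (R : realType) N a M T : supported a M T ->
  base_phi_expansion R N a <->
  N%:R = phi R ^ (M - T%:Z + 1) * word_val R (digits a M T).
Proof.
move=> sa; pose s := [seq M - k%:Z | k <- iota 0 T].
have us : uniq s by rewrite map_inj_uniq ?iota_uniq // => i j; lia.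
have ins i : a i -> i \in s.
  move=> /sa h; apply/mapP; exists `|M - i|%N; last by lia.
  by rewrite mem_iota; lia.
have fin : finite_set [set i | a i].
  by apply: (@sub_finite_set _ _ [set` s]) => // i /ins.
rewrite /base_phi_expansion (@fsbigE _ _ _ _ _ s) //; last first.
  by move=> i _; case ai: (a i); rewrite ?mul0r // (ins i ai).
rewrite big_map.
under eq_bigl do rewrite in_setT.
have -> : iota 0 T = index_iota 0 T by rewrite /index_iota subn0.
by rewrite sum_digits; split=> [[]|].
Qed.

Lemma finite_support_bounded (a : int -> bool) : finite_set [set i | a i] ->
  exists B : nat, forall i, a i -> (`|i| <= B)%N.
Proof.
move=> /finite_seqP[s Es]; exists (\max_(i <- s) `|i|%N) => i ai.
have : i \in s by have : [set i | a i] i by []; rewrite Es.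
by move=> si; apply: (@leq_bigmax_seq _ _ xpredT (fun i => `|i|%N)).
Qed.

Lemma knott_not_ends011 (a : int -> bool) M T :
  supported a M T ->
  (forall lo : int, a lo -> (forall i : int, a i -> lo <= i) ->
    [:: a (lo + 2); a (lo + 1); a lo] <> [:: false; true; true]) ->
  ~ ends011 (digits a M T).
Proof.
move=> sa kn [k []]; rewrite !nth_digits // => h0 h1 h2 h.
have lo1 : M - k.+2%:Z + 1 = M - k.+1%:Z by lia.
have lo2 : M - k.+2%:Z + 2 = M - k%:Z by lia.
apply: (kn (M - k.+2%:Z)); rewrite ?lo1 ?lo2 ?h1 ?h2 ?(negbTE h0) // => i ai.
rewrite leNgt; apply/negP => lt_i.
have iM := sa i ai; have kM : (k.+2 < `|M - i|)%N by lia.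
by have := h _ kM; rewrite nth_digits // (_ : M - _ = i) ?ai //; lia.
Qed.

Lemma not_ends011_knott (a : int -> bool) M T :
  supported a (M - 2) T -> ~ ends011 (digits a M T.+2) ->
  forall lo : int, a lo -> (forall i : int, a i -> lo <= i) ->
    [:: a (lo + 2); a (lo + 1); a lo] <> [:: false; true; true].
Proof.
move=> sa nbad lo alo lomin [a2 a1 a0]; apply: nbad.
have sa' : supported a M T.+2 by move=> i /sa; lia.
have := sa lo alo => hlo.
have Ek : M - (absz (M - 2 - lo)%R)%:Z = lo + 2 by lia.
exists (absz (M - 2 - lo)%R); split; rewrite ?nth_digits //.
- by rewrite Ek a2.
- by rewrite (_ : M - _.+1%:Z = lo + 1) ?a1 //; lia.
- by rewrite (_ : M - _.+2%:Z = lo) ?a0 //; lia.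
by move=> j hj; rewrite nth_digits //; apply/negP => /lomin; lia.
Qed.

Definition place_word (hi : int) (u : seq bool) (i : int) : bool :=
  (i <= hi) && nth false u `|hi - i|%N.

Lemma place_word_supported hi u : supported (place_word hi u) hi (size u).
Proof.
move=> i /andP[le_i nz]; rewrite le_i andbT.
have : (`|hi - i| < size u)%N.
  by rewrite ltnNge; apply/negP => /(nth_default false); rewrite nz.
lia.
Qed.

Lemma digits_place_word hi u : digits (place_word hi u) hi (size u) = u.
Proof.
apply: (@eq_from_nth _ false); rewrite size_digits // => k ku.
rewrite nth_mkseq // /place_word (_ : hi - k%:Z <= hi) /=; last by lia.
by congr nth; lia.
Qed.

Lemma place_word_digits a hi T : supported a hi T -> place_word hi (digits a hi T) = a.
Proof.
move=> sa; apply/funext => i; rewrite /place_word nth_digits //.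
case: (boolP (i <= hi)) => le_i /=; first by congr a; lia.
by apply/esym/negbTE/negP => /sa; lia.
Qed.

(** Zero digits that pad a word on both sides do not change the sequence it
stands for. *)
Lemma place_word_cut a hi p q u : supported a (hi + p%:Z) (p + size u + q) ->
  digits a (hi + p%:Z) (p + size u + q) = nseq p false ++ u ++ nseq q false ->
  a = place_word hi u.
Proof.
move=> sa E; rewrite -(place_word_digits sa) E.
apply/funext => i; rewrite /place_word !nth_cat size_nseq !nth_nseq !if_same.
case: (ltnP (absz (hi + p%:Z - i)%R) p) => hp.
  case: (boolP (i <= hi)) => //= h; last by rewrite andbF.
  by move: hp; lia.
case: (boolP (i <= hi)) => //= le_i; last first.
  by case: (boolP (i <= hi + p%:Z)) => //=; lia.
have -> : (i <= hi + p%:Z) by lia.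
have -> : (absz (hi + p%:Z - i)%R - p = absz (hi - i)%R)%N by lia.
by case: ltnP => //= hu; rewrite nth_default.
Qed.

Lemma sparse_digits (d : int -> bool) M T :
  (forall i : int, ~ (d (i + 1) /\ d i)) -> sparse (digits d M T).
Proof.
move=> no11; apply/(sortedP false) => k; rewrite size_digits => kT.
rewrite !nth_mkseq // ?(ltnW kT) //; apply/negP => /andP[h1 h2].
by apply: (no11 (M - k.+1%:Z)); rewrite (_ : _ + 1 = M - k%:Z) //; lia.
Qed.

Lemma digits_pad d hi T p q : supported d hi T ->
  digits d (hi + p%:Z) (p + T + q) = nseq p false ++ digits d hi T ++ nseq q false.
Proof.
move=> sd; rewrite -addnA !digits_cat addrK (digits_false (M := hi + p%:Z)).
  congr (_ ++ (_ ++ _)); apply: digits_false => i hi_i.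
  by apply/negP => /sd; lia.
by move=> i hi_i; apply/negP => /sd; lia.
Qed.

(** * Knott expansions as words *)

Lemma base_phi_expansion_accepts (R : realType) N a d hi T : supported a hi T ->
  supported d hi T -> bergman_expansion R N d ->
  base_phi_expansion R N a <-> accepts CZero (digits d hi T) (digits a hi T).
Proof.
move=> sa sd [ed no11].
rewrite -(acceptsP R CZero (sparse_digits hi T no11)) ?size_digits //.
rewrite mul0r add0r (base_phi_expansionE R N sa).
move: ed; rewrite (base_phi_expansionE R N sd) => ->.
split=> [/mulfI -> //|/eqP -> //].
by rewrite expfz_neq0 // gt_eqF ?phi_gt0.
Qed.

(** For the direct implication the window must contain the support of [a], about
which nothing is known beforehand; the zeros of [d] on both sides of its own
window then show that [a] exceeds it by at most two places downwards.  In the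
converse two zeros are added in front of [d], so that a final 011 would lie
inside the word even if its 0 is above the top digit. *)
Lemma knott_expansionE (R : realType) N d hi T a : bergman_expansion R N d ->
  supported d hi T -> last false (digits d hi T) ->
  knott_expansion R N a <->
  exists2 u, u \in knott_words CZero (digits d hi T) & a = place_word hi u.
Proof.
move=> bd sd lastd; set w := digits d hi T in lastd *; split.
  move=> [ea kn]; have [B aB] := finite_support_bounded ea.1.
  (* [p] places above and [p.+2] below the window of [d]: all indices of
     nonzero digits of [a] have absolute value at most [B]. *)
  pose p := (B + `|hi|)%N.
  have sa : supported a (hi + p%:Z) (p + T + p.+2).
    by move=> i /aB; rewrite /p; lia.
  have sd' : supported d (hi + p%:Z) (p + T + p.+2) by move=> i /sd; lia.
  have := ea; rewrite (base_phi_expansion_accepts sa sd' bd) digits_pad // catA.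
  move=> acc; have nbad := knott_not_ends011 sa kn.
  have lastw : last (CZero != CInv) (nseq p false ++ w).
    by rewrite last_cat; case: (w) lastd.
  have [u'] := accepts_knott lastw acc nbad.
  rewrite knott_words_zeros => /mapP[u uin ->] E; exists u => //.
  have su : size u = T.+2 by rewrite (size_knott_words uin) size_digits.
  have Tu : (p + T + p.+2 = p + size u + p)%N by rewrite su; lia.
  by apply: (@place_word_cut a hi p p); rewrite -Tu // E catA.
move=> [u uin ->].
have su : size u = T.+2 by rewrite (size_knott_words uin) size_digits.
have sa := @place_word_supported hi u; rewrite su in sa.
have uin' : [:: false, false & u] \in knott_words CZero (nseq 2 false ++ w).
  by rewrite knott_words_zeros; apply/mapP; exists u.
have Ed : digits d (hi + 2) T.+4 = (nseq 2 false ++ w) ++ nseq 2 false.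
  by rewrite -catA -digits_pad // addn2.
have Ea : digits (place_word hi u) (hi + 2) T.+4 = [:: false, false & u].
  have := digits_pad 2 0 sa; rewrite addn0 add2n => ->.
  by rewrite -su digits_place_word cats0.
have sa' : supported (place_word hi u) (hi + 2) T.+4 by move=> i /sa; lia.
have sd' : supported d (hi + 2) T.+4 by move=> i /sd; lia.
split.
  apply/(base_phi_expansion_accepts sa' sd' bd); rewrite Ed Ea.
  exact: knott_words_accepts.
apply: (@not_ends011_knott _ (hi + 2) T.+2); first by rewrite addrK.
rewrite Ea; have sw := sparse_digits (hi + 2) T.+2 bd.2.
have Ew : digits d (hi + 2) T.+2 = nseq 2 false ++ w.
  by have := digits_pad 2 0 sd; rewrite addn0 add2n cats0.
rewrite Ew in sw; apply: (knott_words_no011 sw _ _ uin').1.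
  by rewrite last_cat; case: (w) lastd.
by rewrite /= !ltnS; case: (w) lastd.
Qed.

Lemma place_word_inj hi u v : size u = size v -> place_word hi u = place_word hi v -> u = v.
Proof. by move=> suv E; rewrite -(digits_place_word hi u) E suv digits_place_word. Qed.

Theorem theorem2p3 (R : realType) (N n : nat) (s : nat -> nat) (d : int -> bool)
    (d_bergman : bergman_expansion R N d)
    (d_word : digit_word d (block_word s n)) :
  finite_set [set a | knott_expansion R N a] /\ (tot_knott R N)%:Z = r s n.
Proof.
case: d_word => hi [lo [dhi dlo dsupp Ew]].
set T := `|hi - lo|%N.+1 in Ew.
have sd : supported d hi T by move=> i /dsupp; rewrite /T; lia.
have lastd : last false (digits d hi T) by rewrite /digits -Ew last_block_word.
set K := knott_words CZero (block_word s n).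
have EA : [set a | knott_expansion R N a] =
    [set` [fset place_word hi u | u in K]%fset].
  apply/seteqP; split=> a /=.
    move=> /(knott_expansionE a d_bergman sd lastd)[u]; rewrite /digits -Ew => uK ->.
    by apply/imfsetP; exists u.
  move=> /imfsetP[u /= uK ->].
  apply/(knott_expansionE _ d_bergman sd lastd); rewrite /digits -Ew.
  by exists u.
rewrite EA; split; first exact: finite_fset.
rewrite /tot_knott EA set_fsetK -count_block_word; congr Posz.
rewrite card_in_imfset /=.
  by rewrite /enum_finmem undup_id ?knott_words_uniq.
move=> u v /size_knott_words su /size_knott_words sv.
by apply: place_word_inj; rewrite su sv.
Qed.
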